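(* For every connected graph $G$ of order $n$, $\alpha_{bn}(G)\le n-\delta(G)$, where $\delta(G)$ is the minimum degree of $G$.
   Context: A broadcast on a connected graph $G$ is a function $f:V(G)\to\{0,1,\dots,\operatorname{diam}(G)\}$ with $f(v)\le e(v)$ (the eccentricity of $v$) for every $v$. Let $V_f^+=\{v: f(v)>0\}$. A vertex $u$ hears $f$ from $v\in V_f^+$ if $d_G(u,v)\le f(v)$; $N_f(v)$ is the set of vertices hearing $f$ from $v$ (including $v$), $PN_f(v)$ the set of vertices hearing $f$ only from $v$, and $B_f(v)=\{u\in N_f(v): d_G(u,v)=f(v)\}$. The broadcast $f$ is boundary independent if $N_f(v)\setminus B_f(v)\subseteq PN_f(v)$ for all $v\in V_f^+$. The cost is $\sigma(f)=\sum_v f(v)$, and $\alpha_{bn}(G)$ is the maximum cost of a boundary independent broadcast on $G$ (for the one-vertex graph this is $0$). *)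

(* Defs.v *)
From mathcomp Require Import all_boot.

Set Implicit Arguments.
Unset Strict Implicit.
Unset Printing Implicit Defensive.

(* A finite simple graph is a symmetric irreflexive adjacency relation
   [e : rel T] on a finite type [T] of vertices. *)

Definition connected_graph (T : finType) (e : rel T) : Prop :=
  0 < #|T| /\ forall x y : T, connect e x y.

Definition deg (T : finType) (e : rel T) (v : T) : nat := #|[set u | e v u]|.

(* In a nonempty simple graph every degree is below #|T|, so the default
   value of the iterated minimum never matters. *)
Definition min_deg (T : finType) (e : rel T) : nat :=
  \big[minn/#|T|]_(v : T) deg e v.

Definition has_walk (T : finType) (e : rel T) (x y : T) (k : nat) : bool :=
  [exists p : k.-tuple T, path e x p && (last x p == y)].

(* Least k < #|T| such that there is a walk with k edges from x to y; a
   shortest walk always has fewer than #|T| edges, and the value is the junk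
   #|T| only when x and y are not connected. *)
Definition gdist (T : finType) (e : rel T) (x y : T) : nat :=
  find (has_walk e x y) (iota 0 #|T|).

Definition ecc (T : finType) (e : rel T) (v : T) : nat :=
  \max_(u : T) gdist e v u.

Definition diam (T : finType) (e : rel T) : nat := \max_(v : T) ecc e v.

(* Functions V(G) -> {0, 1, ..., diam(G)}; they form a finite type. *)
Definition bfun (T : finType) (e : rel T) : finType :=
  {ffun T -> 'I_(diam e).+1}.

Definition broadcast (T : finType) (e : rel T) (f : bfun e) : bool :=
  [forall v, f v <= ecc e v].

Definition Vplus (T : finType) (e : rel T) (f : bfun e) : {set T} :=
  [set v | 0 < f v].

(* The sets N_f(v), PN_f(v), B_f(v) are only meant for v in V_f^+. *)
Definition hearing (T : finType) (e : rel T) (f : bfun e) (v : T) : {set T} :=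
  [set u | gdist e u v <= f v].

Definition private_hearing (T : finType) (e : rel T) (f : bfun e) (v : T) :
    {set T} :=
  [set u in hearing f v |
    [forall w in Vplus f, (u \in hearing f w) ==> (w == v)]].

Definition boundary (T : finType) (e : rel T) (f : bfun e) (v : T) : {set T} :=
  [set u in hearing f v | gdist e u v == f v].

Definition boundary_independent (T : finType) (e : rel T) (f : bfun e) : bool :=
  [forall v in Vplus f,
    hearing f v :\: boundary f v \subset private_hearing f v].

Definition cost (T : finType) (e : rel T) (f : bfun e) : nat :=
  \sum_(v : T) f v.

(* The zero broadcast is boundary independent, so this is the maximum of a
   nonempty finite family. *)
Definition alpha_bn (T : finType) (e : rel T) : nat :=
  \max_(f : bfun e | broadcast f && boundary_independent f) cost f.

(* Main.v *)
Require Import Defs.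
From mathcomp Require Import all_boot.

(** Write [B v] for the set of vertices at distance less than [f v] from [v].
    Fix [v0] with [f v0 > 0].  Boundary independence makes the full
    hearing set of [v0] and the sets [B w], [w <> v0], pairwise disjoint.
    Since [f w] is at most the eccentricity of [w], every distance layer inside
    [B w] is nonempty, so [B w] has at least [f w] elements; the hearing set of
    [v0] contains [v0], its neighbours, and the nonempty layers [2, ..., f v0],
    hence has at least [f v0 + delta] elements.  Summing gives
    [cost f + delta <= n]. *)

Section Distance.

Variables (T : finType) (e : rel T).

Lemma has_walkP x y k :
  reflect (exists p, [/\ size p = k, path e x p & last x p = y])
          (has_walk e x y k).
Proof.
apply: (iffP existsP) => [[p /andP[ep /eqP lp]]|[p [sp ep lp]]].
  by exists p; rewrite size_tuple.
by move/eqP: sp => sp; exists (Tuple sp); rewrite /= ep lp eqxx.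
Qed.

Lemma gdist_le_walk x y k : has_walk e x y k -> gdist e x y <= k.
Proof.
move=> wk; have [lekT|ltkT] := leqP #|T| k.
  (* Here [k] lies outside the searched range, but [find] never exceeds the length [#|T|] of that
     range. *)
  by apply: leq_trans lekT; have := find_size (has_walk e x y) (iota 0 #|T|); rewrite size_iota.
rewrite leqNgt; apply/negP => /(before_find 0).
by rewrite nth_iota // add0n wk.
Qed.

Lemma gdist_walk x y : connect e x y -> has_walk e x y (gdist e x y).
Proof.
case/connectP => p0 ep0 ->; case/shortenP: ep0 => p ep up _.
(* The shortened path repeats no vertex, so its length falls inside the searched range. *)
have ltpT : size p < #|T| by rewrite -[(size p).+1]/(size (x :: p)) -(card_uniqP up) max_card.
have hw : has (has_walk e x (last x p)) (iota 0 #|T|).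
  by apply/hasP; exists (size p); [rewrite mem_iota | apply/has_walkP; exists p].
have := nth_find 0 hw; rewrite nth_iota //.
by move: hw; rewrite has_find size_iota.
Qed.

Lemma gdistxx x : gdist e x x = 0.
Proof. by apply/eqP; rewrite -leqn0 gdist_le_walk //; apply/has_walkP; exists [::]. Qed.

Lemma gdist_edge x y z : connect e x y -> e y z -> gdist e x z <= (gdist e x y).+1.
Proof.
move=> /gdist_walk/has_walkP[p [sp ep lp]] eyz.
apply/gdist_le_walk/has_walkP; exists (rcons p z).
by rewrite size_rcons sp rcons_path ep lp last_rcons.
Qed.

Hypothesis e_sym : symmetric e.

Lemma has_walk_sym x y k : has_walk e x y k -> has_walk e y x k.
Proof.
case/has_walkP => p [sp ep <-]; apply/has_walkP; exists (rev (belast x p)).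
rewrite size_rev size_belast rev_path; split=> //.
  by rewrite (eq_path (e' := e)) // => a b; rewrite e_sym.
by case: p {sp ep} => //= a p; rewrite rev_cons last_rcons.
Qed.

Hypothesis e_conn : forall x y, connect e x y.

Lemma gdistC x y : gdist e x y = gdist e y x.
Proof. by apply/eqP; rewrite eqn_leq !gdist_le_walk //; apply/has_walk_sym/gdist_walk. Qed.

(** The penultimate vertex of a shortest walk works: the prefix bounds its distance above, and the
    last edge to [y] bounds it below. *)
Lemma gdist_pred x y d : gdist e x y = d.+1 -> exists z, gdist e x z = d.
Proof.
move=> dxy; have /has_walkP[p] := gdist_walk _ _ (e_conn x y); rewrite dxy.
case: (lastP p) => [[]//|{}p z [/eqP]].
rewrite size_rcons eqSS => /eqP sp; rewrite rcons_path last_rcons.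
case/andP=> ep ez zy; exists (last x p); apply/eqP; rewrite eqn_leq; apply/andP; split.
  by apply/gdist_le_walk/has_walkP; exists p.
by rewrite -ltnS -dxy -zy gdist_edge.
Qed.

Lemma layer_nonempty x i : i <= ecc e x -> exists y, gdist e x y = i.
Proof.
have [y ->] : {y | ecc e x = gdist e x y} by apply: eq_bigmax; apply/card_gt0P; exists x.
move dxy: (gdist e x y) => d; elim: d y dxy => [|d IH] y dxy.
  by rewrite leqn0 => /eqP->; exists y.
rewrite leq_eqVlt => /predU1P[->|]; first by exists y.
by rewrite ltnS; have [z dz] := gdist_pred _ _ _ dxy; apply: (IH z).
Qed.

(** Each unit added to the radius gains a vertex of the next layer. Balls are open, so the last
    layer used is [m + k - 1], hence the successor in the hypothesis. *)
Lemma card_ball_ge x m k : m + k <= (ecc e x).+1 ->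
  #|[set u | gdist e x u < m]| + k <= #|[set u | gdist e x u < m + k]|.
Proof.
elim: k => [|k IH]; first by rewrite !addn0.
rewrite !addnS ltnS => lek; have [y dy] := layer_nonempty _ _ lek.
apply: leq_ltn_trans (IH (leqW lek)) _; apply: proper_card.
apply/properP; split; first by apply/subsetP=> u; rewrite !inE => /ltnW.
by exists y; rewrite !inE dy // ltnn.
Qed.

Lemma min_deg_le v : min_deg e <= deg e v.
Proof.
rewrite /min_deg; have := mem_index_enum v.
elim: (index_enum T) => // a s IH; rewrite big_cons inE geq_min.
by case/predU1P => [->|/IH->]; rewrite ?leqnn ?orbT.
Qed.

Hypothesis e_irr : irreflexive e.

Lemma card_ball2_ge x : (min_deg e).+1 <= #|[set u | gdist e x u < 2]|.
Proof.
apply: leq_ltn_trans (min_deg_le x) _; apply: proper_card.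
(* Irreflexivity makes [x] itself the extra element beyond its neighbours. *)
apply/properP; split; last by exists x; rewrite inE ?gdistxx ?e_irr.
apply/subsetP=> u; rewrite !inE => /(gdist_edge _ _ _ (e_conn x x)).
by rewrite gdistxx.
Qed.

Lemma card_closed_ball_ge x k : 0 < k <= ecc e x ->
  k + min_deg e <= #|[set u | gdist e x u <= k]|.
Proof.
(* Layers 0 and 1 are counted together through the degree; the other [k] layers give one vertex
   each. *)
case: k => // k /= lek; have := card_ball_ge x 2 k.
rewrite add2n ltnS => /(_ lek); apply: leq_trans.
by rewrite addSnnS addnC leq_add2r card_ball2_ge.
Qed.

Lemma cost_min_deg_le (f : bfun e) v0 :
  broadcast f -> boundary_independent f -> 0 < f v0 ->
  cost f + min_deg e <= #|T|.
Proof.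
move=> /forallP bf /forall_inP bif fv0.
(* The summand [w == v0] closes the ball at [v0] only, so one family covers both kinds of sets. *)
pose F w := [set u | gdist e w u < f w + (w == v0)].
(* As [w] is not [v0], a common vertex is interior to the hearing set of [w], hence private to [w];
   yet it also hears [v]. *)
have Fdisj w v : w != v0 -> w != v -> [disjoint F w & F v].
  move=> w0 wv; apply/pred0P => u; apply/negP.
  rewrite /= !inE (negPf w0) addn0 => /andP[uw uv].
  have wp : w \in Vplus f by rewrite inE (leq_ltn_trans _ uw).
  have vp : v \in Vplus f.
    rewrite inE; have [->//|v0'] := eqVneq v v0.
    by move: uv; rewrite (negPf v0') addn0; apply: leq_ltn_trans.
  have /subsetP/(_ u) := bif w wp.
  rewrite !inE !(gdistC u) (ltnW uw) (ltn_eqF uw) => /(_ isT)/= /forall_inP/(_ v vp).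
  rewrite inE gdistC -ltnS (leq_trans uv) /=; first by rewrite eq_sym (negPf wv).
  by case: (v == v0); rewrite ?addn1 ?addn0.
have Fdisj2 w v : w != v -> [disjoint F w & F v].
  have [->|w0 wv] := eqVneq w v0; last exact: Fdisj.
  by rewrite eq_sym disjoint_sym => v0v; apply: Fdisj.
have := partition_disjoint_bigcup addn (fun=> 1) Fdisj2.
rewrite sum1_card => cardF.
apply: leq_trans (max_card (mem (\bigcup_w F w))); rewrite cardF.
under eq_bigr do rewrite sum1_card.
rewrite /cost (bigD1 v0) //= [leqRHS](bigD1 v0) //= addnAC leq_add //.
  have := card_closed_ball_ge v0 (f v0); rewrite fv0 bf => /(_ isT)/leq_trans; apply.
  by apply: subset_leq_card; apply/subsetP=> u; rewrite !inE eqxx addn1.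
apply: leq_sum => w w0; have := card_ball_ge w 0 (f w).
rewrite (leqW (bf w)) => /(_ isT)/(leq_trans (leq_addl _ _))/leq_trans; apply.
by apply: subset_leq_card; apply/subsetP=> u; rewrite !inE (negPf w0) addn0.
Qed.

End Distance.

Theorem theorem3p3 (T : finType) (e : rel T)
  (e_sym : symmetric e) (e_irr : irreflexive e)
  (e_conn : connected_graph e) :
  alpha_bn e <= #|T| - min_deg e.
Proof.
case: e_conn => _ econ; apply/bigmax_leqP => f /andP[bf bif].
have [v0 fv0|f0] := pickP (fun v => 0 < f v).
  have cost_le : cost f + min_deg e <= #|T| by apply: cost_min_deg_le fv0.
  (* [cost_le] also bounds [min_deg e] by [#|T|], so the subtraction does not truncate. *)
  rewrite -(leq_add2r (min_deg e)) subnK //.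
  exact: leq_trans (leq_addl _ _) cost_le.
by rewrite /cost big1 // => v _; apply/eqP; rewrite -leqn0 leqNgt f0.
Qed.
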